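(* For any sequence $\{\mathbb{X}_n\}_{n\in\mathbb{N}}$ of non-trivial normed linear spaces over $\mathbb{K}$, $$\mathcal{D}\left(\bigoplus_1\mathbb{X}_n\right)=\mathcal{D}\left(\bigoplus_0\mathbb{X}_n\right)=2.$$
   Context: $\mathbb{K}=\mathbb{R}$ or $\mathbb{C}$; non-trivial means of dimension more than $0$. $\bigoplus_1\mathbb{X}_n$ and $\bigoplus_0\mathbb{X}_n$ are the spaces of sequences $\{x_n\}$, $x_n\in\mathbb{X}_n$, with respectively $\sum_n\|x_n\|<\infty$ and $\lim_n\|x_n\|=0$, normed by $\|\{x_n\}\|_1=\sum_n\|x_n\|$ and $\|\{x_n\}\|_0=\max_n\|x_n\|$. For a non-zero $x$ in a normed space $\mathbb{X}$, $J(x)=\{f\in\mathbb{X}^*:\|f\|=1,\ f(x)=\|x\|\}$, $D(x)=\operatorname{diam}(J(x))$ (diameter in the norm of $\mathbb{X}^*$), and $\mathcal{D}(\mathbb{X})=\sup\{D(x):x\in\mathbb{X}\setminus\{0\}\}$. *)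

(* Defs.v *)
From HB Require Import structures.
From mathcomp Require Import all_boot all_order all_algebra.
From mathcomp Require Import all_classical all_reals all_analysis.
From mathcomp.real_closed Require Import complex.

Set Implicit Arguments.
Unset Strict Implicit.
Unset Printing Implicit Defensive.

Import Order.TTheory GRing.Theory Num.Theory.
Import numFieldNormedType.Exports.

Local Open Scope classical_set_scope.
Local Open Scope ring_scope.

(** The scalar field is either [R] or [R[i]]. In MathComp the norm of a
    [normedModType K] takes its values in [K] itself, so for [K = R[i]] norms
    are (real) complex numbers; [scalar_re] brings them back to [R], where
    suprema and limits are taken, and [scalar_of] is the embedding [R -> K]. *)

Variant scalar_kind := RealScalars | ComplexScalars.

Definition scalars (R : realType) (k : scalar_kind) : numFieldType :=
  match k with
  | RealScalars => R
  | ComplexScalars => R[i]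
  end.

Definition scalar_re (R : realType) (k : scalar_kind) : scalars R k -> R :=
  match k with
  | RealScalars => fun z : R => z
  | ComplexScalars => fun z : R[i] => complex.Re z
  end.

Definition scalar_of (R : realType) (k : scalar_kind) : R -> scalars R k :=
  match k with
  | RealScalars => fun a : R => a
  | ComplexScalars => fun a : R => real_complex R a
  end.

Section Scalars.
Context {R : realType} {k : scalar_kind}.
Implicit Types (a b : R) (z w : scalars R k).

Lemma scalar_ofK a : scalar_re (scalar_of k a) = a.
Proof. by case: k. Qed.

Lemma scalar_of0 : scalar_of k (0 : R) = 0.
Proof. by case: k. Qed.

Lemma scalar_ofD a b : scalar_of k (a + b) = scalar_of k a + scalar_of k b.
Proof. by case: k => //=; rewrite rmorphD. Qed.

Lemma scalar_ofM a b : scalar_of k (a * b) = scalar_of k a * scalar_of k b.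
Proof. by case: k => //=; rewrite rmorphM. Qed.

Lemma scalar_of_le a b : (scalar_of k a <= scalar_of k b) = (a <= b).
Proof. by case: k => //=; rewrite lecR. Qed.

Lemma scalar_re_ge0 z : 0 <= z -> scalar_of k (scalar_re z) = z.
Proof.
case: k z => //= -[x y]; rewrite lecE/= => /andP[/eqP -> _].
by [].
Qed.

Lemma scalar_of_inj : injective (@scalar_of R k).
Proof. exact: can_inj scalar_ofK. Qed.

End Scalars.

Section RealNorm.
Context {R : realType} {k : scalar_kind}.

Definition rnorm (V : normedZmodType (scalars R k)) (x : V) : R :=
  scalar_re `|x|.

Lemma rnormK (V : normedZmodType (scalars R k)) (x : V) :
  scalar_of k (rnorm x) = `|x|.
Proof. by rewrite scalar_re_ge0. Qed.

Lemma rnorm_ge0 (V : normedZmodType (scalars R k)) (x : V) : 0 <= rnorm x.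
Proof. by rewrite -(@scalar_of_le R k) rnormK scalar_of0. Qed.

Lemma rnormD (V : normedZmodType (scalars R k)) (x y : V) :
  rnorm (x + y) <= rnorm x + rnorm y.
Proof. by rewrite -(@scalar_of_le R k) scalar_ofD !rnormK ler_normD. Qed.

Lemma rnorm0 (V : normedZmodType (scalars R k)) : rnorm (0 : V) = 0.
Proof. by apply: (@scalar_of_inj R k); rewrite rnormK normr0 scalar_of0. Qed.

Lemma rnorm0_eq0 (V : normedZmodType (scalars R k)) (x : V) :
  rnorm x = 0 -> x = 0.
Proof. by move=> x0; apply/normr0_eq0; rewrite -rnormK x0 scalar_of0. Qed.

Lemma rnormZ (V : normedModType (scalars R k)) (l : scalars R k) (x : V) :
  rnorm (l *: x) = rnorm l * rnorm x.
Proof.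
by apply: (@scalar_of_inj R k); rewrite scalar_ofM !rnormK normrZ.
Qed.

End RealNorm.

Section DualityMap.
Context {R : realType} {k : scalar_kind}.
Local Notation K := (scalars R k).
Local Open Scope ereal_scope.

(** The norm of the dual space; it is [+oo] on unbounded functionals. *)
Definition dual_norm (V : normedModType K) (f : V -> K^o) : \bar R :=
  ereal_sup [set (rnorm (f x))%:E | x in [set x : V | (rnorm x <= 1)%R]].

(** [norming x], [norming_diam x] and [max_norming_diam V] are J(x),
    D(x) and 𝒟(V). The suprema are taken in [\bar R], so that no boundedness
    is presupposed; the convention [ereal_sup set0 = -oo] only matters for the
    zero space. *)
Definition norming (V : normedModType K) (x : V) : set {linear V -> K^o} :=
  [set f | [/\ continuous f, dual_norm f = 1 & f x = `|x|%R]].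

Definition norming_diam (V : normedModType K) (x : V) : \bar R :=
  ereal_sup [set d | exists f g : {linear V -> K^o},
    [/\ norming x f, norming x g & d = dual_norm (f \- g)%R]].

Definition max_norming_diam (V : normedModType K) : \bar R :=
  ereal_sup [set norming_diam x | x in [set x : V | x != 0%R]].

End DualityMap.

Section Sequences.
Context {R : realType} {k : scalar_kind}.
Local Notation K := (scalars R k).
Variable X : nat -> normedModType K.

Definition pi_seq := forall n, X n.

HB.instance Definition _ := Choice.on pi_seq.

Implicit Types x y z : pi_seq.

Definition pi_zero : pi_seq := fun=> 0.
Definition pi_opp x : pi_seq := fun n => - x n.
Definition pi_add x y : pi_seq := fun n => x n + y n.
Definition pi_scale (l : K) x : pi_seq := fun n => l *: x n.

Let pi_addA : associative pi_add.
Proof. by move=> x y z; apply/functional_extensionality_dep => n; exact: addrA. Qed.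
Let pi_addC : commutative pi_add.
Proof. by move=> x y; apply/functional_extensionality_dep => n; exact: addrC. Qed.
Let pi_add0 : left_id pi_zero pi_add.
Proof. by move=> x; apply/functional_extensionality_dep => n; exact: add0r. Qed.
Let pi_addN : left_inverse pi_zero pi_opp pi_add.
Proof. by move=> x; apply/functional_extensionality_dep => n; exact: addNr. Qed.

HB.instance Definition _ :=
  GRing.isZmodule.Build pi_seq pi_addA pi_addC pi_add0 pi_addN.

Let pi_scaleA l m x : pi_scale l (pi_scale m x) = pi_scale (l * m) x.
Proof. by apply/functional_extensionality_dep => n; exact: scalerA. Qed.
Let pi_scale1 : left_id 1 pi_scale.
Proof. by move=> x; apply/functional_extensionality_dep => n; exact: scale1r. Qed.
Let pi_scaleDr : right_distributive pi_scale +%R.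
Proof. by move=> l x y; apply/functional_extensionality_dep => n; exact: scalerDr. Qed.
Let pi_scaleDl x : {morph pi_scale^~ x : l m / l + m}.
Proof. by move=> l m; apply/functional_extensionality_dep => n; exact: scalerDl. Qed.

HB.instance Definition _ := GRing.Zmodule_isLmodule.Build K pi_seq
  pi_scaleA pi_scale1 pi_scaleDr pi_scaleDl.

Lemma pi_addE x y n : (x + y) n = x n + y n. Proof. by []. Qed.
Lemma pi_scaleE l x n : (l *: x) n = l *: x n. Proof. by []. Qed.
Lemma pi_zeroE n : (0 : pi_seq) n = 0. Proof. by []. Qed.

Definition norms x : R^nat := fun n => rnorm (x n).

Lemma norms0 : norms 0 = cst 0.
Proof. by apply/funext => n; rewrite /norms pi_zeroE rnorm0. Qed.

Lemma normsZ l x : norms (l *: x) = rnorm l *: norms x.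
Proof. by apply/funext => n; rewrite /norms pi_scaleE rnormZ. Qed.

Lemma normsD x y n : norms (x + y) n <= (norms x + norms y) n.
Proof. exact: rnormD. Qed.

Lemma norms_ge0 x n : 0 <= norms x n.
Proof. exact: rnorm_ge0. Qed.

Lemma norms_eq0 x : (forall n, norms x n = 0) -> x = 0.
Proof.
by move=> x0; apply/functional_extensionality_dep => n; exact: rnorm0_eq0 (x0 n).
Qed.

Definition summable_seq : pred pi_seq :=
  fun x => `[< cvgn (series (norms x)) >].

Definition null_seq : pred pi_seq :=
  fun x => `[< norms x @ \oo --> (0 : R) >].

Lemma summable_seq_subsemimod : subsemimod_closed summable_seq.
Proof.
split; [split|].
- apply/asboolP; rewrite norms0; apply: (@is_cvg_near_cst _ R^o).
  by near=> n; rewrite seriesEnat/= big1 // => i _.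
- move=> x y /asboolP cx /asboolP cy; apply/asboolP.
  apply: (@series_le_cvg R _ (norms x + norms y)).
  + exact: norms_ge0.
  + by move=> n; apply: addr_ge0; exact: norms_ge0.
  + exact: normsD.
  + exact: is_cvg_seriesD.
- move=> l x /asboolP cx; apply/asboolP; rewrite normsZ.
  exact: is_cvg_seriesZ.
Unshelve. all: by end_near. Qed.

Lemma null_seq_subsemimod : subsemimod_closed null_seq.
Proof.
split; [split|].
- by apply/asboolP; rewrite norms0; exact: cvg_cst.
- move=> x y /asboolP cx /asboolP cy; apply/asboolP.
  apply: (@squeeze_cvgr _ _ _ _ (cst 0) (norms x + norms y)).
  + by near=> n; rewrite norms_ge0 normsD.
  + exact: cvg_cst.
  + by rewrite -[X in _ --> X]addr0; exact: cvgD.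
- move=> l x /asboolP cx; apply/asboolP; rewrite normsZ.
  by rewrite -(mulr0 (rnorm l)); apply: cvgMr.
Unshelve. all: by end_near. Qed.

(** The l1-sum and the c0-sum of the spaces [X n], as linear subspaces of the
    product; [rnorm_dsum1E] and [rnorm_dsum0E] below compute their norms. *)
Record dsum1 := Dsum1 { dsum1_val :> pi_seq ; _ : summable_seq dsum1_val }.

HB.instance Definition _ := [isSub for dsum1_val].
HB.instance Definition _ := [Choice of dsum1 by <:].
HB.instance Definition _ := GRing.SubChoice_isSubLmodule.Build
  K pi_seq summable_seq dsum1 summable_seq_subsemimod.

Record dsum0 := Dsum0 { dsum0_val :> pi_seq ; _ : null_seq dsum0_val }.

HB.instance Definition _ := [isSub for dsum0_val].
HB.instance Definition _ := [Choice of dsum0 by <:].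
HB.instance Definition _ := GRing.SubChoice_isSubLmodule.Build
  K pi_seq null_seq dsum0 null_seq_subsemimod.

Definition dsum1_norm (x : dsum1) : R := limn (series (norms x)).

Definition dsum0_norm (x : dsum0) : R := sup (range (norms x)).

Lemma dsum1P (x : dsum1) : cvgn (series (norms x)).
Proof. by case: x => x /= /asboolP. Qed.

Lemma dsum0P (x : dsum0) : norms x @ \oo --> (0 : R).
Proof. by case: x => x /= /asboolP. Qed.

Lemma dsum1_normD (x y : dsum1) : dsum1_norm (x + y) <= dsum1_norm x + dsum1_norm y.
Proof.
rewrite /dsum1_norm -lim_seriesD; try exact: dsum1P.
apply: lim_series_le; first exact: dsum1P.
  by apply: is_cvg_seriesD; exact: dsum1P.
by move=> n; exact: normsD.
Qed.

Lemma dsum1_normZ (l : K) (x : dsum1) :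
  dsum1_norm (l *: x) = rnorm l * dsum1_norm x.
Proof.
rewrite /dsum1_norm -[RHS]/(rnorm l *: (_ : R^o)) -lim_seriesZ; last exact: dsum1P.
by rewrite -normsZ.
Qed.

Lemma norms_le_dsum1_norm (x : dsum1) n : norms x n <= dsum1_norm x.
Proof.
apply: (@le_trans _ _ (series (norms x) n.+1)).
  rewrite seriesEnat/= big_nat_recr//= lerDr.
  by apply: sumr_ge0 => i _; exact: norms_ge0.
apply: nondecreasing_cvgn_le; last exact: dsum1P.
apply/nondecreasing_seqP => m; rewrite !seriesEnat/= big_nat_recr//= lerDl.
exact: norms_ge0.
Qed.

Lemma dsum1_norm_eq0 (x : dsum1) : dsum1_norm x = 0 -> x = 0.
Proof.
move=> x0; apply/val_inj/norms_eq0 => n; apply/eqP.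
by rewrite eq_le norms_ge0 andbT -x0 norms_le_dsum1_norm.
Qed.

Lemma dsum0_bounded (x : dsum0) : has_sup (range (norms x)).
Proof.
split; first by exists (norms x 0); exists 0%N.
have /cvg_seq_bounded : cvgn (norms x) by apply/cvg_ex; exists 0; exact: dsum0P.
move=> /pinfty_ex_gt0[M M0 xM]; exists M => _ [n _ <-].
by apply: le_trans (ler_norm _) _; exact: xM.
Qed.

Lemma norms_le_dsum0_norm (x : dsum0) n : norms x n <= dsum0_norm x.
Proof. by apply: sup_upper_bound; [exact: dsum0_bounded|exists n]. Qed.

(** The supremum defining [dsum0_norm] is a maximum. *)
Lemma dsum0_norm_attained (x : dsum0) : exists n, dsum0_norm x = norms x n.
Proof.
have s0 : 0 <= dsum0_norm x.
  exact: le_trans (norms_ge0 x 0%N) (norms_le_dsum0_norm x 0%N).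
apply: contrapT => /forallNP nx.
have lts n : norms x n < dsum0_norm x.
  by rewrite lt_neqAle norms_le_dsum0_norm andbT; apply/eqP => /esym/nx.
have sgt0 : 0 < dsum0_norm x := le_lt_trans (norms_ge0 x 0%N) (lts 0%N).
have [N _ xN] : \forall n \near \oo, norms x n < dsum0_norm x / 2.
  by apply: (cvgr_lt 0 (dsum0P x)); exact: divr_gt0.
pose m : R := \big[Num.max/dsum0_norm x / 2]_(i < N) norms x i.
have ms : m < dsum0_norm x.
  apply: bigmax_lt => [|i _]; [by rewrite ltr_pdivrMr// mulr_natr mulr2n ltrDl|].
  exact: lts.
have : dsum0_norm x <= m.
  apply: sup_le_ub => [|_ [n _ <-]]; first by case: (dsum0_bounded x).
  have [nN|Nn] := ltnP n N.
    exact: (le_bigmax _ (fun i : 'I_N => norms x i) (Ordinal nN)).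
  by apply: (le_trans (ltW (xN n Nn))); exact: bigmax_ge_id.
by rewrite leNgt ms.
Qed.

Lemma dsum0_normD (x y : dsum0) : dsum0_norm (x + y) <= dsum0_norm x + dsum0_norm y.
Proof.
have [n ->] := dsum0_norm_attained (x + y).
by apply: le_trans (normsD _ _ _) _; apply: lerD; exact: norms_le_dsum0_norm.
Qed.

Lemma dsum0_normZ (l : K) (x : dsum0) :
  dsum0_norm (l *: x) = rnorm l * dsum0_norm x.
Proof.
have lx n : norms (l *: x : dsum0) n = rnorm l * norms x n.
  by rewrite -[LHS]/(norms (l *: (x : pi_seq)) n) normsZ.
apply/eqP; rewrite eq_le; apply/andP; split.
  have [n ->] := dsum0_norm_attained (l *: x).
  by rewrite lx ler_wpM2l ?rnorm_ge0 ?norms_le_dsum0_norm.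
have [n ->] := dsum0_norm_attained x.
by rewrite -lx norms_le_dsum0_norm.
Qed.

Lemma dsum0_norm_eq0 (x : dsum0) : dsum0_norm x = 0 -> x = 0.
Proof.
move=> x0; apply/val_inj/norms_eq0 => n; apply/eqP.
by rewrite eq_le norms_ge0 andbT -x0 norms_le_dsum0_norm.
Qed.

Let norm1 (x : dsum1) : K := scalar_of k (dsum1_norm x).
Let norm0 (x : dsum0) : K := scalar_of k (dsum0_norm x).

Let norm1D (x y : dsum1) : norm1 (x + y) <= norm1 x + norm1 y.
Proof. by rewrite /norm1 -scalar_ofD scalar_of_le dsum1_normD. Qed.
Let norm0D (x y : dsum0) : norm0 (x + y) <= norm0 x + norm0 y.
Proof. by rewrite /norm0 -scalar_ofD scalar_of_le dsum0_normD. Qed.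
Let norm1Z (l : K) (x : dsum1) : norm1 (l *: x) = `|l| * norm1 x.
Proof. by rewrite /norm1 dsum1_normZ scalar_ofM rnormK. Qed.
Let norm0Z (l : K) (x : dsum0) : norm0 (l *: x) = `|l| * norm0 x.
Proof. by rewrite /norm0 dsum0_normZ scalar_ofM rnormK. Qed.
Let norm1_eq0 (x : dsum1) : norm1 x = 0 -> x = 0.
Proof.
by rewrite /norm1 -scalar_of0 => /scalar_of_inj; exact: dsum1_norm_eq0.
Qed.
Let norm0_eq0 (x : dsum0) : norm0 x = 0 -> x = 0.
Proof.
by rewrite /norm0 -scalar_of0 => /scalar_of_inj; exact: dsum0_norm_eq0.
Qed.

HB.instance Definition _ :=
  Lmodule_isNormed.Build K dsum1 norm1D norm1Z norm1_eq0.
HB.instance Definition _ :=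
  Lmodule_isNormed.Build K dsum0 norm0D norm0Z norm0_eq0.

Lemma rnorm_dsum1E (x : dsum1) : rnorm x = limn (series (norms x)).
Proof. exact: scalar_ofK. Qed.

Lemma rnorm_dsum0E (x : dsum0) : rnorm x = sup (range (norms x)).
Proof. exact: scalar_ofK. Qed.

End Sequences.

(* Main.v *)
(** Both values are at most 2 because [J(x)] lies in the dual unit ball. Fix
    unit vectors [u0], [u1] in the first two summands and norming functionals
    [f0], [f1] of them. In the l1-sum, [(f0, f1)] and [(f0, -f1)] both norm
    [(u0, 0, ...)] and differ by 2 at [(0, u1, 0, ...)]. In the c0-sum,
    [(f0, 0, ...)] and [(0, f1, 0, ...)] both norm [(u0, u1, 0, ...)] and
    differ by 2 at [(u0, -u1, 0, ...)].

    Norming functionals come from a form of Hahn-Banach without partially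
    defined functionals: by Zorn's lemma every sublinear functional dominates
    a minimal one, and minimal sublinear functionals are linear. *)

From HB Require Import structures.
Require Import Defs.
From mathcomp Require Import all_boot all_order all_algebra.
From mathcomp Require Import all_classical all_reals all_analysis.
From mathcomp.real_closed Require Import complex.
From mathcomp Require Import ring lra.

Set Implicit Arguments.
Unset Strict Implicit.
Unset Printing Implicit Defensive.

Import Order.TTheory GRing.Theory Num.Theory.
Import numFieldNormedType.Exports.

Local Open Scope classical_set_scope.
Local Open Scope ring_scope.

(** * Real-valued norms and phases of scalars *)

Section ScalarNorm.
Context {R : realType} {k : scalar_kind}.
Local Notation K := (scalars R k).

Lemma scalar_of1 : scalar_of k (1 : R) = 1.
Proof. by case: k. Qed.

Lemma scalar_ofN (a : R) : scalar_of k (- a) = - scalar_of k a.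
Proof. by case: k => //=; rewrite rmorphN. Qed.

Lemma rnorm_scalar_of (a : R) : 0 <= a -> rnorm (scalar_of k a : K) = a.
Proof.
move=> a0; rewrite /rnorm ger0_norm ?scalar_ofK//.
by rewrite -(scalar_of0 (R := R)) scalar_of_le.
Qed.

Lemma le_scalar_re_rnorm (z : K) : scalar_re z <= rnorm z.
Proof.
rewrite /rnorm; case: k z => /= z; first exact: ler_norm.
have := normc_ge_Re z; rewrite lecE => /andP[_] /=.
exact/le_trans/ler_norm.
Qed.

(** Such a rotation turns a bound on real parts into a bound on moduli. *)
Lemma ex_phase (z : K) : exists2 c : K, rnorm c = 1 & c * z = `|z|.
Proof.
suff [c c1 cz] : exists2 c : K, `|c| = 1 & c * z = `|z|.
  by exists c => //; rewrite /rnorm c1 -scalar_of1 scalar_ofK.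
have [->|z0] := eqVneq z 0; first by exists 1; rewrite ?normr1// mulr0 normr0.
exists (`|z| / z); last by rewrite divfK.
by rewrite normrM normfV normr_id divff// normr_eq0.
Qed.

Lemma rnormN (V : normedZmodType K) (x : V) : rnorm (- x) = rnorm x.
Proof. by rewrite /rnorm normrN. Qed.

End ScalarNorm.

(** * Sublinear functionals and real-linear minorants *)

Section Sublinear.
Context {R : realType} {k : scalar_kind} {V : lmodType (scalars R k)}.
Implicit Types (p q : V -> R) (a t : R) (x y : V) (F : set (V -> R)).

(** Only real scalars enter, so a complex space is treated as a real one. Equality in the
    homogeneity clause follows by rescaling. *)
Definition sublinear p :=
  (forall x y, p (x + y) <= p x + p y) /\
  (forall a x, 0 <= a -> p (scalar_of k a *: x) <= a * p x).

Lemma sublinear0 p : sublinear p -> p 0 = 0.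
Proof.
move=> [pD pZ]; apply/eqP; rewrite eq_le; apply/andP; split.
  by have := pZ 0 0 (lexx 0); rewrite scaler0 mul0r.
by have := pD 0 0; rewrite addr0 -subr_ge0 addrK.
Qed.

Lemma sublinearZ p a x : sublinear p -> 0 <= a ->
  p (scalar_of k a *: x) = a * p x.
Proof.
move=> ps; rewrite le_eqVlt => /predU1P[<-|a0].
  by rewrite scalar_of0 scale0r mul0r sublinear0.
apply/eqP; rewrite eq_le; apply/andP; split; first exact/ps.2/ltW.
(* The reverse inequality is homogeneity for [a^-1] at the vector [a x]. *)
rewrite -ler_pdivlMl//.
have := ps.2 a^-1 (scalar_of k a *: x).
rewrite scalerA -scalar_ofM mulVf ?gt_eqF// scalar_of1 scale1r; apply.
by rewrite invr_ge0 ltW.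
Qed.

Lemma sublinear_ge p x : sublinear p -> - p (- x) <= p x.
Proof.
move=> ps; have := ps.1 x (- x).
by rewrite subrr sublinear0//; lra.
Qed.

Definition pointwise_inf F x : R := inf [set p x | p in F].

Lemma pointwise_inf_le F p x : has_lbound [set p x | p in F] -> F p ->
  pointwise_inf F x <= p x.
Proof. by move=> Fx Fp; apply: ge_inf => //; exists p. Qed.

(** The members of [F] need not be sublinear themselves: it suffices that each required bound is met
    by some member [r], and then one passes to infima. *)
Lemma sublinear_pointwise_inf F : F !=set0 ->
    (forall x, has_lbound [set p x | p in F]) ->
    (forall p q x y, F p -> F q ->
       exists2 r, F r & r (x + y) <= p x + q y) ->
    (forall a p x, 0 <= a -> F p ->
       exists2 r, F r & r (scalar_of k a *: x) <= a * p x) ->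
  sublinear (pointwise_inf F).
Proof.
move=> [p0 Fp0] Flb FD FZ.
have ne x : [set p x | p in F] !=set0 by exists (p0 x), p0.
split=> [x y|a x a0].
  rewrite -lerBlDr; apply: lb_le_inf => // _ [p Fp <-].
  rewrite lerBlDr -lerBlDl; apply: lb_le_inf => // _ [q Fq <-].
  rewrite lerBlDl; have [r Fr] := FD p q x y Fp Fq.
  by apply: le_trans; exact: pointwise_inf_le.
(* Pulling [a] through the infimum divides by it, so [a = 0] is separate. *)
move: (a0); rewrite le_eqVlt => /predU1P[a0'|agt0].
  have [r Fr rle] := FZ a p0 x a0 Fp0.
  apply: le_trans (pointwise_inf_le _ Fr) _ => //.
  by move: rle; rewrite -a0' !mul0r.
rewrite -ler_pdivrMl//; apply: lb_le_inf => // _ [p Fp <-].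
rewrite ler_pdivrMl//; have [r Fr] := FZ a p x a0 Fp.
by apply: le_trans; exact: pointwise_inf_le.
Qed.

(** If [q] is sublinear, below [p], and [q (- y) <= - p y], then [q x <= q (x + t y) + t q (- y) <=
    p (x + t y) - t p y]: these are the bounds collected here. *)
Definition shifts p y : set (V -> R) := [set q | exists2 t, 0 <= t &
  q = fun x => p (x + scalar_of k t *: y) - t * p y].

(** The largest sublinear functional below [p] whose value at [- y] is at most
    [- p y]. *)
Definition odd_at p y : V -> R := pointwise_inf (shifts p y).

Section OddAt.
Variables (p : V -> R) (y : V).
Hypothesis ps : sublinear p.

Let shifts_lb x : has_lbound [set q x | q in shifts p y].
Proof.
(* Indeed [t p y = p (t y) <= p (x + t y) + p (- x)]. *)
exists (- p (- x)) => _ [_ [t t0 ->] <-].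
rewrite lerBrDr addrC lerBlDr -sublinearZ//.
by rewrite (le_trans _ (ps.1 _ _))// addrAC subrr add0r.
Qed.

(** Shifts by [t] and [s] combine into the shift by [t + s], and scaling by [a] turns the shift by
    [t] into that by [a * t]. *)
Lemma sublinear_odd_at : sublinear (odd_at p y).
Proof.
apply: sublinear_pointwise_inf => //.
- by exists (fun x => p (x + scalar_of k 0 *: y) - 0 * p y), 0.
- move=> _ _ x z [t t0 ->] [s s0 ->].
  exists (fun x => p (x + scalar_of k (t + s) *: y) - (t + s) * p y).
    by exists (t + s) => //; exact: addr_ge0.
  rewrite scalar_ofD scalerDl addrACA.
  have := ps.1 (x + scalar_of k t *: y) (z + scalar_of k s *: y); lra.
- move=> a _ x a0 [t t0 ->].
  exists (fun x => p (x + scalar_of k (a * t) *: y) - (a * t) * p y).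
    by exists (a * t) => //; exact: mulr_ge0.
  rewrite scalar_ofM -scalerA -scalerDr mulrBr mulrA lerB//.
  exact: ps.2.
Qed.

Lemma odd_at_le_shift t x : 0 <= t ->
  odd_at p y x <= p (x + scalar_of k t *: y) - t * p y.
Proof.
move=> t0; pose q x := p (x + scalar_of k t *: y) - t * p y.
by apply: (@pointwise_inf_le _ q) => //; exists t.
Qed.

Lemma odd_at_le x : odd_at p y x <= p x.
Proof.
apply: le_trans (odd_at_le_shift _ (lexx 0)) _.
by rewrite scalar_of0 scale0r addr0 mul0r subr0.
Qed.

(** This is the shift with [t = 1]; at [x = - y] the right side is [- p y]. *)
Lemma odd_at_le_add x : odd_at p y x <= p (x + y) - p y.
Proof.
by have := odd_at_le_shift x ler01; rewrite scalar_of1 scale1r mul1r.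
Qed.

End OddAt.

Lemma ex_minimal_sublinear p0 : sublinear p0 ->
  exists p, [/\ sublinear p, forall x, p x <= p0 x &
    forall q, sublinear q -> (forall x, q x <= p x) -> q = p].
Proof.
move=> p0s.
pose T := {p : V -> R | sublinear p /\ forall x, p x <= p0 x}.
(* The order is reversed, so that a maximal element for Zorn is a minimal functional. *)
pose le (p q : T) : bool := `[< forall x, sval q x <= sval p x >].
(* A lower bound independent of [p] makes the infimum over a chain finite. *)
have lb (p : T) x : - p0 (- x) <= sval p x.
  case: p => p [ps ple] /=; apply: le_trans (sublinear_ge x ps).
  by rewrite lerN2.
have [||||p pmax] := @Zorn T le.
- by move=> p; apply/asboolP.
- move=> p q r /asboolP pq /asboolP qr; apply/asboolP => x.
  exact: le_trans (qr x) (pq x).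
- move=> [p Pp] [q Pq] /asboolP/= pq /asboolP/= qp; apply: eq_exist.
  by apply/funext => x; apply/eqP; rewrite eq_le qp pq.
- move=> A Atot; have [[q Aq]|A0] := pselect (A !=set0); last first.
    (* The empty chain is bounded by [p0] itself. *)
    exists (exist _ p0 (conj p0s (fun=> lexx _))) => s As.
    by case: A0; exists s.
  pose F : set (V -> R) := [set sval p | p in A].
  have Flb x : has_lbound [set p x | p in F].
    by exists (- p0 (- x)) => _ [_ [p Ap <-] <-].
  have Fs : sublinear (pointwise_inf F).
    apply: sublinear_pointwise_inf => //.
    + by exists (sval q), q.
    + move=> _ _ x y [r Ar <-] [s As <-].
      have [/asboolP rs|/asboolP sr] := Atot _ _ Ar As.
        exists (sval s); first by exists s.
        by apply: le_trans ((svalP s).1.1 _ _) _; exact: lerD.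
      exists (sval r); first by exists r.
      by apply: le_trans ((svalP r).1.1 _ _) _; exact: lerD.
    + move=> a _ x a0 [r Ar <-]; exists (sval r); first by exists r.
      exact: (svalP r).1.2.
  have Fle (p : T) x : A p -> pointwise_inf F x <= sval p x.
    by move=> Ap; apply: pointwise_inf_le => //; exists p.
  have Fp0 x : pointwise_inf F x <= p0 x.
    exact: le_trans (Fle _ _ Aq) ((svalP q).2 x).
  exists (exist _ (pointwise_inf F) (conj Fs Fp0)) => s As.
  by apply/asboolP => x; exact: Fle.
exists (sval p); split; [exact: (svalP p).1|exact: (svalP p).2|].
move=> q qs qp.
have qp0 x : q x <= p0 x := le_trans (qp x) ((svalP p).2 x).
by rewrite -(pmax (exist _ q (conj qs qp0)))//; apply/asboolP.
Qed.

(** By minimality [f] equals [odd_at f y] for every [y], so [f x <= f (x + y) - f y]; together with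
    subadditivity this gives additivity. *)
Lemma ex_linear_le_sublinear p : sublinear p -> exists f : V -> R,
  [/\ {morph f : x y / x + y}, (forall a x, f (scalar_of k a *: x) = a * f x) &
      forall x, f x <= p x].
Proof.
move=> /ex_minimal_sublinear[f [fs fp fmin]]; exists f.
have fD : {morph f : x y / x + y}.
  move=> x y; apply/eqP; rewrite eq_le fs.1/= -lerBrDr.
  have {1}<- := fmin _ (sublinear_odd_at y fs) (odd_at_le y fs).
  exact: odd_at_le_add.
have fN x : f (- x) = - f x.
  by apply/eqP; rewrite -addr_eq0 -fD addNr sublinear0.
split=> // a x; have [a0|a0] := leP 0 a; first exact: sublinearZ.
rewrite -[a]opprK scalar_ofN scaleNr fN sublinearZ ?mulNr//.
by rewrite oppr_ge0 ltW.
Qed.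

End Sublinear.

(** * Norming functionals over both scalar fields *)

Section NormingFunctional.
Context {R : realType} {k : scalar_kind}.
Local Notation K := (scalars R k).

Lemma ex_linear_real_part (V : lmodType K) (r : V -> R) :
    {morph r : x y / x + y} ->
    (forall a x, r (scalar_of k a *: x) = a * r x) ->
  exists f : {linear V -> K^o}, forall x, scalar_re (f x) = r x.
Proof.
case: k V r => V r rD rZ.
  have rl : linear (r : V -> R^o) by move=> a x y; rewrite rD rZ.
  pose rM := GRing.isLinear.Build _ _ _ _ (r : V -> R^o) rl.
  pose f : {linear V -> R^o} := HB.pack (r : V -> R^o) rM.
  by exists f.
(* Complex linearity forces the imaginary part at [x] to be minus the real part at [i x]. *)
pose g (x : V) : (R[i])^o := Complex (r x) (- r ('i%C *: x)).
have rC (l : R[i]) x :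
    r (l *: x) = complex.Re l * r x + complex.Im l * r ('i%C *: x).
  rewrite -(rZ (complex.Re l) x) -(rZ (complex.Im l)) -rD; congr r.
  rewrite scalerA -scalerDl; congr (_ *: _); case: l => a b.
  by apply/eqP; rewrite eq_complex/=; apply/andP; split; apply/eqP; ring.
have gl : linear g.
  move=> [a b] x y.
  have r1 := rC (a +i* b)%C x.
  have r2 : r ('i%C *: ((a +i* b)%C *: x + y)) =
      - b * r x + a * r ('i%C *: x) + r ('i%C *: y).
    by rewrite scalerDr scalerA rD rC/=; congr (_ * _ + _ * _ + _); ring.
  rewrite /g r2 rD r1.
  apply/eqP; rewrite eq_complex /=.
  by apply/andP; split; apply/eqP; ring.
pose gM := GRing.isLinear.Build _ _ _ _ g gl.
pose f : {linear V -> (R[i])^o} := HB.pack g gM.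
by exists f.
Qed.

(** Starting from [odd_at] of the norm at [u], instead of the norm, forces [r (- u) <= - rnorm u]
    for the linear minorant [r], that is, [rnorm u <= r u]. *)
Lemma ex_norming_functional (V : normedModType K) (u : V) :
  exists2 f : {linear V -> K^o},
    forall x, rnorm (f x) <= rnorm x & f u = `|u|.
Proof.
have ns : sublinear (@rnorm R k V).
  split=> [|a x a0]; first exact: rnormD.
  by rewrite rnormZ rnorm_scalar_of.
have [r [rD rZ rle]] := ex_linear_le_sublinear (sublinear_odd_at u ns).
have rN x : r (- x) = - r x.
  by have := rZ (- 1) x; rewrite scalar_ofN scalar_of1 scaleN1r mulN1r.
have ru : rnorm u <= r u.
  rewrite -[r u]opprK -rN lerNr; apply: le_trans (rle _) _.
  by apply: le_trans (odd_at_le_add _ ns _) _; rewrite addNr rnorm0 sub0r.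
have [f fr] := ex_linear_real_part rD rZ.
have fle x : rnorm (f x) <= rnorm x.
  (* After rotation [f (c x)] is the modulus of [f x], hence equal to its real part [r (c x)]. *)
  have [c c1 cfx] := ex_phase (f x).
  have -> : rnorm (f x) = r (c *: x).
    by rewrite -fr linearZ/= /rnorm -cfx.
  apply: le_trans (rle _) _; apply: le_trans (odd_at_le _ ns _) _.
  by rewrite rnormZ c1 mul1r.
(* The modulus of [f u] is the norm of [u]; a last rotation makes the value itself equal to it. *)
have [c c1 cfu] := ex_phase (f u).
exists (c \*: f) => [x/=|].
  by rewrite rnormZ c1 mul1r.
rewrite /= [LHS]cfu -!rnormK; congr scalar_of; apply/eqP; rewrite eq_le fle/=.
by rewrite (le_trans ru)// -fr le_scalar_re_rnorm.
Qed.

End NormingFunctional.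

(** * Upper bound 2 and a criterion for equality *)

Section NormingDiameter.
Context {R : realType} {k : scalar_kind}.
Local Notation K := (scalars R k).
Implicit Types V : normedModType K.

Lemma continuous_contraction V (f : {linear V -> K^o}) :
  (forall x, rnorm (f x) <= rnorm x) -> continuous f.
Proof.
move=> fle; apply/bounded_linear_continuous/linear_boundedP.
near=> M => x; apply: (@le_trans _ _ `|x|).
  by rewrite -!rnormK scalar_of_le.
by rewrite ler_peMl//; near: M; apply: nbhs_pinfty_ge; rewrite real1.
Unshelve. all: by end_near. Qed.

Lemma dual_norm_ge V (f : V -> K^o) x :
  rnorm x <= 1 -> ((rnorm (f x))%:E <= dual_norm f)%E.
Proof. by move=> x1; apply: ereal_sup_ubound; exists x. Qed.

Lemma dual_norm_le V (f : V -> K^o) (M : \bar R) :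
  (forall x, rnorm x <= 1 -> ((rnorm (f x))%:E <= M)%E) -> (dual_norm f <= M)%E.
Proof. by move=> fM; apply: ge_ereal_sup => _ [x x1 <-]; exact: fM. Qed.

Lemma max_norming_diam_le2 V : (max_norming_diam V <= 2%:E)%E.
Proof.
apply: ge_ereal_sup => _ [x _ <-]; apply: ge_ereal_sup => _ [f [g [fx gx ->]]].
have le1 (h : {linear V -> K^o}) y :
    norming x h -> rnorm y <= 1 -> rnorm (h y) <= 1.
  by move=> [_ h1 _] /(dual_norm_ge h); rewrite h1 lee_fin.
apply: dual_norm_le => y y1; rewrite lee_fin (le_trans (rnormD _ _))//.
by rewrite rnormN (natrD _ 1 1) lerD// le1.
Qed.

Lemma norming_contraction V (x : V) (f : {linear V -> K^o}) :
  rnorm x = 1 -> (forall y, rnorm (f y) <= rnorm y) -> f x = `|x| ->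
  norming x f.
Proof.
move=> x1 fle fx; split=> //; first exact: continuous_contraction.
apply/eqP; rewrite eq_le; apply/andP; split.
  by apply: dual_norm_le => y y1; rewrite lee_fin (le_trans (fle y)).
have /(dual_norm_ge f) : rnorm x <= 1 by rewrite x1.
by rewrite fx {1}/rnorm normr_id -/(rnorm x) x1.
Qed.

(** The vector [z] of the unit ball witnesses that [f - g] has dual norm at least 2, so each sum
    only needs a choice of [x], [z], [f] and [g]. *)
Lemma max_norming_diam_eq2 V (x z : V) (f g : {linear V -> K^o}) :
    rnorm x = 1 -> rnorm z <= 1 ->
    (forall y, rnorm (f y) <= rnorm y) -> (forall y, rnorm (g y) <= rnorm y) ->
    f x = `|x| -> g x = `|x| -> f z - g z = 2 ->
  max_norming_diam V = 2%:E.
Proof.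
move=> x1 z1 fle gle fx gx fgz.
apply/eqP; rewrite eq_le max_norming_diam_le2/=.
have x0 : x != 0.
  by apply: contra_eq_neq x1 => ->; rewrite rnorm0 eq_sym oner_neq0.
apply: (@le_trans _ _ (norming_diam x)); last first.
  by apply: ereal_sup_ubound; exists x.
apply: (@le_trans _ _ (dual_norm (f \- g))); last first.
  apply: ereal_sup_ubound; exists f, g.
  by split=> //; exact: norming_contraction.
apply: le_trans (dual_norm_ge _ z1); rewrite lee_fin /= fgz.
have -> : (2 : K) = scalar_of k 2.
  by rewrite (natrD _ 1 1) scalar_ofD scalar_of1.
by rewrite rnorm_scalar_of.
Qed.

End NormingDiameter.

(** * Coordinate maps and finitely supported sequences *)

Section Sums.
Context {R : realType} {k : scalar_kind}.
Local Notation K := (scalars R k).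
Variable X : nat -> normedModType K.

Definition dsum1_coord n (x : dsum1 X) : X n := dsum1_val x n.
Definition dsum0_coord n (x : dsum0 X) : X n := dsum0_val x n.

Let dsum1_coord_linear n : linear (dsum1_coord n).
Proof. by []. Qed.
Let dsum0_coord_linear n : linear (dsum0_coord n).
Proof. by []. Qed.

HB.instance Definition _ n :=
  GRing.isLinear.Build _ _ _ _ (dsum1_coord n) (dsum1_coord_linear n).
HB.instance Definition _ n :=
  GRing.isLinear.Build _ _ _ _ (dsum0_coord n) (dsum0_coord_linear n).

Lemma rnorm_coord_dsum0 (x : dsum0 X) n :
  rnorm (dsum0_coord n x) <= rnorm x.
Proof. by rewrite rnorm_dsum0E; exact: norms_le_dsum0_norm. Qed.

(** The left side is a partial sum of the series of norms. The bound makes the sum and the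
    difference of contractions on the first two coordinates contractions. *)
Lemma rnorm_coord2_dsum1 (x : dsum1 X) :
  rnorm (dsum1_coord 0 x) + rnorm (dsum1_coord 1 x) <= rnorm x.
Proof.
rewrite rnorm_dsum1E; apply: (@le_trans _ _ (series (norms x) 2)).
  by rewrite seriesEnat/= !big_nat_recr//= big_nil add0r.
apply: nondecreasing_cvgn_le; last exact: dsum1P.
apply/nondecreasing_seqP => m; rewrite !seriesEnat/= big_nat_recr//= lerDl.
exact: norms_ge0.
Qed.

Variable u : forall n, X n.

Definition scaled_seq (c : nat -> K) : pi_seq X := fun n => c n *: u n.

Section FiniteSupport.
Variable c : nat -> K.
Hypothesis c0 : forall n, (2 <= n)%N -> c n = 0.

Let norms_scaled n : (2 <= n)%N -> norms (scaled_seq c) n = 0.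
Proof. by move=> n2; rewrite /norms /scaled_seq c0// scale0r rnorm0. Qed.

Let series_scaled : \forall n \near \oo,
  series (norms (scaled_seq c)) n = rnorm (c 0 *: u 0) + rnorm (c 1 *: u 1).
Proof.
near=> n; have n2 : (2 <= n)%N by near: n; exact: nbhs_infty_ge.
rewrite seriesEnat/= (@big_cat_nat _ _ _ 2)//=.
rewrite [X in _ + X]big_nat_cond [X in _ + X]big1 ?addr0.
  by rewrite !big_nat_recr//= big_nil add0r.
by move=> i /andP[/andP[i2 _] _]; exact: norms_scaled.
Unshelve. all: by end_near. Qed.

Lemma scaled_seq_summable : summable_seq (scaled_seq c).
Proof. by apply/asboolP; apply: is_cvg_near_cst series_scaled. Qed.

Lemma scaled_seq_null : null_seq (scaled_seq c).
Proof.
apply/asboolP; apply: cvg_near_cst; near=> n.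
by apply: norms_scaled; near: n; exact: nbhs_infty_ge.
Unshelve. all: by end_near. Qed.

Definition scaled1 : dsum1 X := Dsum1 scaled_seq_summable.
Definition scaled0 : dsum0 X := Dsum0 scaled_seq_null.

Lemma rnorm_scaled1 : rnorm scaled1 = rnorm (c 0 *: u 0) + rnorm (c 1 *: u 1).
Proof.
by rewrite rnorm_dsum1E; apply: lim_near_cst series_scaled; exact: Rhausdorff.
Qed.

Lemma rnorm_scaled0_le M : rnorm (c 0 *: u 0) <= M -> rnorm (c 1 *: u 1) <= M ->
  rnorm scaled0 <= M.
Proof.
move=> M0 M1; rewrite rnorm_dsum0E -/(dsum0_norm scaled0).
have [[|[|n]] -> //] := dsum0_norm_attained scaled0.
(* Beyond index 1 the norm is 0, and [M] is nonnegative because it bounds a norm. *)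
by rewrite norms_scaled// (le_trans _ M0)// rnorm_ge0.
Qed.

End FiniteSupport.

End Sums.

(** * Unit vectors and the choice of functionals in the two sums *)

Lemma ex_unit_vector (R : realType) (k : scalar_kind)
    (V : normedModType (scalars R k)) :
  (exists x : V, x != 0) -> exists u : V, rnorm u = 1.
Proof.
move=> [x x0]; exists (`|x|^-1 *: x).
rewrite /rnorm normrZ normfV normr_id mulVf ?normr_eq0//.
by rewrite -(scalar_of1 (R := R)) scalar_ofK.
Qed.

Theorem corollary17 (R : realType) (k : scalar_kind)
    (X : nat -> normedModType (scalars R k))
    (X_nontrivial : forall n, exists x : X n, x != 0) :
  max_norming_diam (dsum1 X) = 2%:E /\ max_norming_diam (dsum0 X) = 2%:E.
Proof.
have [u u1] : exists u : forall n, X n, forall n, rnorm (u n) = 1.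
  pose v n := cid (ex_unit_vector (X_nontrivial n)).
  by exists (fun n => sval (v n)) => n; exact: (svalP (v n)).
have nu n : `|u n| = 1 by rewrite -rnormK u1 scalar_of1.
have [f fle fu] := ex_norming_functional (u 0%N).
have [g gle gu] := ex_norming_functional (u 1%N).
(* The type of [supp a b] carries the coefficient sequence [a, b, 0, 0, ...], which [scaled1] and
   [scaled0] read off by unification. *)
have supp (a b : scalars R k) n :
    (2 <= n)%N -> (if n is m.+1 then (if m is 0 then b else 0) else a) = 0.
  by case: n => [|[|n]].
rewrite nu in fu; rewrite nu in gu.
split.
  pose x := scaled1 u (supp 1 0); pose z := scaled1 u (supp 0 1).
  pose F : {linear dsum1 X -> (scalars R k)^o} :=
    (f \o dsum1_coord 0) \+ (g \o dsum1_coord 1).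
  pose G : {linear dsum1 X -> (scalars R k)^o} :=
    (f \o dsum1_coord 0) \- (g \o dsum1_coord 1).
  have x1 : rnorm x = 1.
    by rewrite rnorm_scaled1/= scale1r scale0r u1 rnorm0 addr0.
  have z1 : rnorm z = 1.
    by rewrite rnorm_scaled1/= scale1r scale0r u1 rnorm0 add0r.
  have nx : `|x| = 1 by rewrite -rnormK x1 scalar_of1.
  apply: (@max_norming_diam_eq2 _ _ _ x z F G) => //.
  - by rewrite z1.
  - move=> y; apply: le_trans (rnorm_coord2_dsum1 y).
    rewrite /F /=; apply: le_trans (rnormD _ _) _.
    exact: (lerD (fle _) (gle _)).
  - move=> y; apply: le_trans (rnorm_coord2_dsum1 y).
    rewrite /G /=; apply: le_trans (rnormD _ _) _; rewrite rnormN.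
    exact: (lerD (fle _) (gle _)).
  - rewrite nx /F /= /dsum1_coord /= /scaled_seq scale1r scale0r fu linear0.
    by rewrite addr0.
  - rewrite nx /G /= /dsum1_coord /= /scaled_seq scale1r scale0r fu linear0.
    by rewrite subr0.
  - rewrite /F /G /= /dsum1_coord /= /scaled_seq scale1r scale0r gu linear0.
    by rewrite add0r sub0r opprK.
(* Both coordinates of [x] attain the maximum, so either one alone norms it; the sign in [z] gives
   the values 1 and -1. *)
pose x := scaled0 u (supp 1 1); pose z := scaled0 u (supp 1 (- 1)).
pose F : {linear dsum0 X -> (scalars R k)^o} := f \o dsum0_coord 0.
pose G : {linear dsum0 X -> (scalars R k)^o} := g \o dsum0_coord 1.
have x1 : rnorm x = 1.
  apply/eqP; rewrite eq_le rnorm_scaled0_le/= ?scale1r ?u1//.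
  have := rnorm_coord_dsum0 x 0.
  by rewrite /= /scaled_seq scale1r u1.
have nx : `|x| = 1 by rewrite -rnormK x1 scalar_of1.
apply: (@max_norming_diam_eq2 _ _ _ x z F G) => //.
- by apply: rnorm_scaled0_le; rewrite ?scaleN1r ?rnormN ?scale1r u1.
- by move=> y; apply: le_trans (fle _) (rnorm_coord_dsum0 _ _).
- by move=> y; apply: le_trans (gle _) (rnorm_coord_dsum0 _ _).
- by rewrite nx /F /= /dsum0_coord /= /scaled_seq scale1r fu.
- by rewrite nx /G /= /dsum0_coord /= /scaled_seq scale1r gu.
- rewrite /F /G /= /dsum0_coord /= /scaled_seq scaleN1r scale1r linearN fu gu.
  by rewrite opprK.
Qed.
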